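(* Let $\lambda=(\lambda_1,\dots,\lambda_m)$ be a partition with conjugate $\mu=(\mu_1,\dots,\mu_k)$. Let $(i_1,j_1),\dots,(i_r,j_r)$ be the removable cells of the Young diagram of $\lambda$, and let $\lambda^-_s$ be the partition obtained from $\lambda$ by removing the cell $(i_s,j_s)$. Then $$b_\lambda(q)=\sum_{s=1}^r[\mu_{j_s-1}-(i_s-1)]_q\,b_{\lambda^-_s}(q),$$ where $\mu_{j_s-1}-(i_s-1)$ is interpreted as $1$ if $j_s=1$.
   Context: The Young diagram of $\lambda$ is $\{(i,j):1\le i\le m,1\le j\le\lambda_i\}$; a cell is removable if deleting it leaves the Young diagram of a partition. The conjugate $\mu$ has $\mu_j$ equal to the number of parts of $\lambda$ that are $\ge j$. $[a]_q=1+q+\dots+q^{a-1}$. For a standard tableau $T$ of shape $\lambda$ (filling by $1,\dots,|\lambda|$ with increasing rows and columns) and $2\le j\le\lambda_i$, $c_{ij}(T)=\#\{i'\ge i:\text{cell }(i',j-1)\text{ exists and }T_{i',j-1}<T_{ij}\}$, $c_q(T)=\prod_i\prod_{j=2}^{\lambda_i}[c_{ij}(T)]_q$, and $b_\lambda(q)=\sum_T c_q(T)$ over standard tableaux of shape $\lambda$ (with $b_\emptyset=1$). *)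

(* Defs.v *)
From HB Require Import structures.
From mathcomp Require Import all_boot all_order all_algebra.
Set Implicit Arguments.
Unset Strict Implicit.
Unset Printing Implicit Defensive.
Import GRing.Theory.
Local Open Scope nat_scope.

(* Partitions are weakly decreasing sequences of positive naturals.  Parts,
   rows and columns are numbered from 1. *)
Definition is_partition (la : seq nat) : bool :=
  sorted geq la && all (leq 1) la.

Definition part (la : seq nat) (i : nat) : nat := nth 0 la i.-1.

Definition conjugate (la : seq nat) : seq nat :=
  [seq count (leq j) la | j <- iota 1 (part la 1)].

Definition diagram (la : seq nat) : seq (nat * nat) :=
  [seq (i, j) | i <- iota 1 (size la), j <- iota 1 (part la i)].

Definition obtained_by_removing (la : seq nat) (x : nat * nat) (nu : seq nat)
    : Prop :=
  is_partition nu /\ diagram nu =i [predD1 diagram la & x].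

Definition removable (la : seq nat) (x : nat * nat) : Prop :=
  x \in diagram la /\ exists nu, obtained_by_removing la x nu.

Definition cell (la : seq nat) : finType := seq_sub (diagram la).

Definition cell_row (la : seq nat) (x : cell la) : nat := (val x).1.
Definition cell_col (la : seq nat) (x : cell la) : nat := (val x).2.

(* A value k : 'I_(sumn la) stands for the entry k.+1; the shift affects
   neither comparisons between entries nor the statistic below. *)
Definition filling (la : seq nat) : finType := {ffun cell la -> 'I_(sumn la)}.

Definition is_standard (la : seq nat) (T : filling la) : bool :=
  [&& [forall k, #|[set x | T x == k]| == 1],
      [forall x, forall y,
         (cell_row x == cell_row y) && (cell_col x < cell_col y) ==> (T x < T y)]
    & [forall x, forall y,
         (cell_col x == cell_col y) && (cell_row x < cell_row y) ==> (T x < T y)]].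

Definition c_stat (la : seq nat) (T : filling la) (x : cell la) : nat :=
  #|[set y : cell la |
      [&& cell_row x <= cell_row y, (cell_col y).+1 == cell_col x & T y < T x]]|.

Local Open Scope ring_scope.

Definition qint (a : nat) : {poly int} := \sum_(0 <= i < a) 'X^i.

Definition c_q (la : seq nat) (T : filling la) : {poly int} :=
  \prod_(x : cell la | (2 <= cell_col x)%N) qint (c_stat T x).

Definition b_poly (la : seq nat) : {poly int} :=
  \sum_(T : filling la | is_standard T) c_q T.

Lemma b_poly_nil : b_poly [::] = 1.
Proof.
have no (x : cell [::]) : False by case: x.
pose T0 : filling [::] := [ffun x => match no x with end].
rewrite /b_poly (big_pred1 T0) => [|T].
  by rewrite /c_q big1 // => x; case: (no x).
have -> : T = T0 by apply/ffunP => x; case: (no x).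
rewrite /= eqxx /is_standard; apply/and3P; split; apply/forallP => x.
- by case: x.
- by case: (no x).
- by case: (no x).
Qed.

(* Main.v *)
Require Import Defs.
From mathcomp Require Import all_boot all_order all_algebra.
From mathcomp Require Import zify.
Set Implicit Arguments.
Unset Strict Implicit.
Unset Printing Implicit Defensive.
Import GRing.Theory.
Local Open Scope ring_scope.

(** The largest entry of a standard tableau of shape [la] sits in a removable
    cell [z], and deleting it gives a bijection between the tableaux with
    largest entry in [z] and the standard tableaux of shape [la] minus [z].  The
    largest entry is never smaller than another entry, so the statistics of the
    other cells do not change, while the statistic of [z = (i, j)] counts all
    cells of column [j - 1] in rows [>= i], of which there are
    [mu_(j-1) - (i - 1)]. *)

Local Open Scope nat_scope.

(** * Diagrams of partitions *)

(** Since [part] is 0 below the last row, [0 < j <= part la i] already bounds the row. The condition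
    [0 < i] has to be kept, because [part la 0] reads the first row. *)
Lemma mem_diagram (la : seq nat) (i j : nat) :
  ((i, j) \in diagram la) = [&& 0 < i, 0 < j & j <= part la i].
Proof.
apply/allpairsPdep/idP => [[i' [j' [+ + [-> ->]]]]|/and3P[i0 j0 jle]].
  by rewrite !mem_iota => /andP[-> _]; rewrite add1n ltnS.
exists i, j; rewrite !mem_iota i0 j0 !add1n !ltnS jle; split => //=.
case: leqP => // lt; move: jle; rewrite /part nth_default ?leqn0; lia.
Qed.

Lemma diagram_uniq (la : seq nat) : uniq (diagram la).
Proof.
apply: allpairs_uniq_dep => [|i _|]; rewrite ?iota_uniq //.
by move=> [i j] [i' j'] _ _ /= [-> ->].
Qed.

Lemma size_diagram (la : seq nat) : size (diagram la) = sumn la.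
Proof.
rewrite size_allpairs_dep; congr sumn; apply: (@eq_from_nth _ 0).
  by rewrite size_map size_iota.
move=> k; rewrite size_map size_iota => klt.
by rewrite (nth_map 0) ?size_iota // nth_iota // size_iota add1n.
Qed.

Lemma card_cell (la : seq nat) : #|{: cell la}| = sumn la.
Proof. by rewrite card_seq_sub ?diagram_uniq ?size_diagram. Qed.

Lemma leq_part (la : seq nat) (i i' : nat) :
  is_partition la -> i <= i' -> part la i' <= part la i.
Proof.
case/andP => srt _ lei; rewrite /part.
case: (ltnP i'.-1 (size la)) => [lt|le]; last by rewrite nth_default.
have tr : transitive geq by move=> a b c; rewrite /geq /=; lia.
have := @sorted_leq_nth _ geq tr (leqnn : reflexive geq) 0 la srt.
by apply; rewrite ?inE; lia.
Qed.

(** Parts weakly decrease, so the rows of length at least [c] form an initial segment, whose length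
    is the height of column [c]. *)
Lemma leq_count_part (la : seq nat) (i c : nat) :
  is_partition la -> 0 < i -> 0 < c -> (c <= part la i) = (i <= count (leq c) la).
Proof.
move=> /andP[+ _] + c0; elim: la i => [|a la IH] i srt i0.
  by rewrite /part nth_nil /=; lia.
have {}IH := IH _ (path_sorted srt).
have le_a : all (geq a) la.
  by apply: order_path_min srt => x y z; rewrite /geq /=; lia.
case: (leqP c a) => ca /=.
  case: i i0 => [|[|i]] // _; rewrite ca ?add1n //.
  by rewrite ltnS -IH.
rewrite [c <= a]leqNgt ca add0n.
have -> : count (leq c) la = 0.
  apply/eqP; rewrite -leqn0 leqNgt -has_count; apply/hasPn => x xl.
  by move/allP: le_a => /(_ x xl) /=; rewrite /geq /=; lia.
case: i i0 => [|[|i]] // _; rewrite /part /=; first lia.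
case: (ltnP i (size la)) => il; last by rewrite nth_default //; lia.
by move/allP: le_a => /(_ _ (mem_nth 0 il)); rewrite /geq /=; lia.
Qed.

Lemma part_conjugate (la : seq nat) (c : nat) :
  0 < c -> c <= part la 1 -> part (conjugate la) c = count (leq c) la.
Proof.
move=> c0 cle; rewrite /part (nth_map 0) ?size_iota; last lia.
by rewrite nth_iota; [rewrite add1n prednK|lia].
Qed.

Lemma is_partitionP (la : seq nat) :
  reflect ((forall k, k.+1 < size la -> nth 0 la k.+1 <= nth 0 la k)
           /\ (forall k, k < size la -> 0 < nth 0 la k))
          (is_partition la).
Proof.
apply: (iffP andP) => [[/(sortedP 0) srt /(all_nthP 0) ps]|[srt ps]]; split => //.
  exact/(sortedP 0).
exact/(all_nthP 0).
Qed.

(** Row [i] has length exactly [j] and the next row is shorter, so lowering this part by one keeps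
    the parts weakly decreasing. *)
Lemma corner_removable (la : seq nat) (i j : nat) :
  is_partition la -> (i, j) \in diagram la ->
  (i, j.+1) \notin diagram la -> (i.+1, j) \notin diagram la ->
  removable la (i, j).
Proof.
move=> pla zla right below; split=> //.
move: zla right below; rewrite !mem_diagram => /and3P[i0 j0 jle] right below.
have jE : nth 0 la i.-1 = j by move: right jle; rewrite /part; lia.
have below' : nth 0 la i < j by move: below; rewrite /part /=; lia.
have isz : i.-1 < size la.
  by rewrite ltnNge; apply/negP => /(nth_default 0) E; lia.
have [srt ps] := is_partitionP _ pla.
(* Parts must stay positive, so a row of length 1 has to disappear. The next row is then empty, so
   row [i] is the last one and truncation removes it. *)
case: (eqVneq j 1) => [j1|jn1].
  have szE : size la = i.
    case: (ltnP i (size la)) => [/ps|]; lia.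
  exists (take i.-1 la).
  have szt : size (take i.-1 la) = i.-1 by rewrite size_takel //; lia.
  split.
    apply/is_partitionP; split=> k; rewrite szt => kl; rewrite !nth_take; try lia.
      by apply: srt; lia.
    by apply: ps; lia.
  case=> i' j'; rewrite inE /= !mem_diagram xpair_eqE /part.
  case: (ltnP i'.-1 i.-1) => lt.
    by rewrite nth_take //; lia.
  rewrite nth_default ?szt //.
  case: (eqVneq i' i) => [->|ne]; first by rewrite jE; lia.
  case: (posnP i') => [->|i'0]; first lia.
  by rewrite (nth_default _ (n := i'.-1)) //; lia.
exists (set_nth 0 la i.-1 j.-1).
have szt : size (set_nth 0 la i.-1 j.-1) = size la by rewrite size_set_nth; lia.
split.
  apply/is_partitionP; split=> k; rewrite szt => kl; rewrite !nth_set_nth /=.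
    have := srt _ kl.
    case: eqP => [E1|_]; case: eqP => [E2|_]; try lia.
    - by rewrite E1 jE; lia.
    - by move=> _; have -> : k.+1 = i; lia.
  by have := ps _ kl; case: eqP; lia.
case=> i' j'; rewrite inE /= !mem_diagram xpair_eqE /part nth_set_nth /=.
case: (posnP i') => [->|i'0]; first lia.
case: eqP => [E|ne]; last by have -> : (i' == i) = false; lia.
have -> : i' = i by lia.
by rewrite jE; lia.
Qed.

(** * Standard fillings *)

(** There are as many cells as values, so injectivity amounts to each value being taken exactly
    once. *)
Lemma is_standardP (la : seq nat) (T : filling la) :
  reflect [/\ injective T,
     forall x y, cell_row x = cell_row y -> cell_col x < cell_col y -> T x < T y
   & forall x y, cell_col x = cell_col y -> cell_row x < cell_row y -> T x < T y]
  (is_standard T).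
Proof.
have monoP (f g : cell la -> nat) :
  reflect (forall x y, f x = f y -> g x < g y -> T x < T y)
    [forall x, forall y, (f x == f y) && (g x < g y) ==> (T x < T y)].
  apply: (iffP forallP) => [H x y E lt|H x].
    by move/forallP: (H x) => /(_ y); rewrite E eqxx lt.
  by apply/forallP => y; apply/implyP => /andP[/eqP E lt]; apply: H.
apply: (iffP and3P) => [[one /monoP R /monoP C]|[inj R C]]; split=> //; try exact/monoP.
  move=> x y E; move/forallP: one => /(_ (T x)) /cards1P[w wE].
  have : x \in [set x0 | T x0 == T x] by rewrite inE.
  have : y \in [set x0 | T x0 == T x] by rewrite inE E.
  by rewrite wE !inE => /eqP-> /eqP->.
have surj : #|'I_(sumn la)| <= #|{: cell la}| by rewrite card_ord card_cell.
apply/forallP => k.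
have /codomP[x ->] : k \in codom T by apply: (inj_card_onto inj surj).
apply/cards1P; exists x; apply/setP => y; rewrite !inE.
exact: inj_eq.
Qed.

(** Values are entries shifted down by one, so the successor is compared with the number of
    cells. *)
Definition holds_max (la : seq nat) (T : filling la) (x : cell la) : bool :=
  (T x).+1 == sumn la.

Lemma ltn_holds_max (la : seq nat) (T : filling la) (x y : cell la) :
  is_standard T -> holds_max T x -> y != x -> T y < T x.
Proof.
move=> /is_standardP[inj _ _] /eqP mx ne.
have : T y <= T x by rewrite -ltnS mx.
rewrite leq_eqVlt => /orP[/eqP E|//].
by rewrite (inj y x) ?eqxx // in ne; apply: val_inj.
Qed.

(** A neighbour to the right or below would have to carry a strictly larger entry, so the cell is a
    corner. *)
Lemma holds_max_removable (la : seq nat) (T : filling la) (x : cell la) :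
  is_partition la -> is_standard T -> holds_max T x -> removable la (val x).
Proof.
move=> pla sT mx; case: x mx => -[i j] zla mx; set z := SeqSub _ in mx *.
have [_ R C] := is_standardP _ sT.
have big_false (y : cell la) : T z < T y -> False.
  by move: (ltn_ord (T y)) mx; rewrite /holds_max; lia.
apply: corner_removable => //; apply/negP => yla.
  by apply: (big_false (SeqSub yla)); apply: R.
by apply: (big_false (SeqSub yla)); apply: C.
Qed.

Local Open Scope ring_scope.

(** A nonempty standard tableau has exactly one cell with the largest entry. All cells are allowed
    here; those that are not removable will contribute empty sums. *)
Lemma b_poly_split_max (la : seq nat) : (0 < sumn la)%N ->
  b_poly la =
    \sum_(x : cell la) \sum_(T : filling la | is_standard T && holds_max T x) c_q T.
Proof.
move=> n0; under eq_bigr do rewrite big_mkcondr.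
rewrite exchange_big /=; apply: eq_bigr => T sT.
have lt : ((sumn la).-1 < sumn la)%N by lia.
have /and3P[/forallP/(_ (Ordinal lt))/cards1P[x xE] _ _] := sT.
rewrite -big_mkcond (big_pred1 x) // => y.
have : (y \in [set x | T x == Ordinal lt]) = (y == x) by rewrite xE inE.
rewrite inE -val_eqE /= => <-; rewrite /holds_max.
by apply/eqP/eqP => [/(congr1 predn)|->] //; rewrite prednK.
Qed.

(** * Deleting the largest entry *)

Local Open Scope nat_scope.

Definition cell_incl (nu la : seq nat) (H : {subset diagram nu <= diagram la})
  (y : cell nu) : cell la := SeqSub (H _ (ssvalP y)).

Lemma cell_incl_inj (nu la : seq nat) (H : {subset diagram nu <= diagram la}) :
  injective (cell_incl H).
Proof. by move=> x y [] /val_inj. Qed.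

(** This is the inverse of deletion. [insub] detects the cells of [nu]; any other cell receives the
    value [sumn nu], the largest possible one when a single cell was removed. *)
Definition extend_filling (nu la : seq nat) (lt : sumn nu < sumn la)
    (T : filling nu) : filling la :=
  [ffun x => oapp (fun y => widen_ord (ltnW lt) (T y)) (Ordinal lt) (insub (val x))].

Lemma extend_filling_incl (nu la : seq nat) (lt : sumn nu < sumn la)
    (H : {subset diagram nu <= diagram la}) (T : filling nu) (y : cell nu) :
  extend_filling lt T (cell_incl H y) = T y :> nat.
Proof. by rewrite ffunE /= (valK y). Qed.

Lemma extend_filling_out (nu la : seq nat) (lt : sumn nu < sumn la)
    (T : filling nu) (x : cell la) :
  val x \notin diagram nu -> extend_filling lt T x = sumn nu :> nat.
Proof. by move=> out; rewrite ffunE /= insubN. Qed.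

Lemma removing_sub (la nu : seq nat) (z : nat * nat) :
  obtained_by_removing la z nu -> {subset diagram nu <= diagram la}.
Proof. by case=> _ E x; rewrite E => /andP[]. Qed.

Lemma removing_sumn (la nu : seq nat) (z : nat * nat) :
  z \in diagram la -> obtained_by_removing la z nu -> sumn la = (sumn nu).+1.
Proof.
move=> zla [_ E]; rewrite -!size_diagram.
have /perm_size -> : perm_eq (diagram la) (z :: diagram nu).
  apply: uniq_perm; rewrite /= ?diagram_uniq ?E ?inE /= ?eqxx // => x.
  by rewrite inE E inE /=; case: eqVneq => [->|].
by [].
Qed.

Lemma removing_cell (la nu : seq nat) (z x : cell la)
    (rem : obtained_by_removing la (val z) nu) :
  x != z -> exists y, x = cell_incl (removing_sub rem) y.
Proof.
move=> ne; have xnu : val x \in diagram nu.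
  by case: rem => _ ->; rewrite inE /= val_eqE ne ssvalP.
by exists (SeqSub xnu); apply: val_inj.
Qed.

Lemma removing_notin (la nu : seq nat) (z : nat * nat) :
  obtained_by_removing la z nu -> z \notin diagram nu.
Proof. by case=> _ ->; rewrite inE /= eqxx. Qed.

Lemma cell_incl_neq (la nu : seq nat) (z : cell la) (y : cell nu)
    (rem : obtained_by_removing la (val z) nu) :
  cell_incl (removing_sub rem) y != z.
Proof.
by apply: contra (removing_notin rem) => /eqP <-; apply: ssvalP.
Qed.

(** Rows shorten downwards, so a Young diagram is closed under moving up and left. *)
Lemma diagram_down (nu : seq nat) (x y : nat * nat) :
  is_partition nu -> y \in diagram nu -> 0 < x.1 -> 0 < x.2 ->
  x.1 <= y.1 -> x.2 <= y.2 -> x \in diagram nu.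
Proof.
case: x y => i j [i' j'] pnu; rewrite !mem_diagram /= => /and3P[_ _ le] -> -> lei lej /=.
by apply: leq_trans lej (leq_trans le (leq_part _ _)).
Qed.

Lemma extend_filling_standard (la nu : seq nat) (z : cell la)
    (rem : obtained_by_removing la (val z) nu) (lt : sumn nu < sumn la)
    (T : filling nu) :
  is_standard T ->
  is_standard (extend_filling lt T) && holds_max (extend_filling lt T) z.
Proof.
move=> /is_standardP[inj R C].
have Ez := extend_filling_out lt T (removing_notin rem).
have Ei := extend_filling_incl lt (removing_sub rem) T.
have ltz y : extend_filling lt T (cell_incl (removing_sub rem) y)
             < extend_filling lt T z by rewrite Ez Ei.
(* A cell of [nu] weakly below and to the right of [z] would force [z] into the diagram of [nu],
   from which it was removed. Hence the maximum at [z] violates no row or column condition. *)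
have corner y : cell_row z <= cell_row (cell_incl (removing_sub rem) y) ->
    cell_col z <= cell_col (cell_incl (removing_sub rem) y) -> False.
  move=> r c; move: (removing_notin rem); apply/negP/negPn.
  have [pnu _] := rem.
  have := ssvalP z; rewrite [ssval z]surjective_pairing mem_diagram => /and3P[i0 j0 _].
  exact: (@diagram_down nu _ (val y)) (ssvalP y) i0 j0 r c.
apply/andP; split; last by rewrite /holds_max Ez (removing_sumn (ssvalP z) rem).
apply/is_standardP; split=> x y.
- case: (eqVneq x z) => [->|/(removing_cell rem)[x' ->]];
  case: (eqVneq y z) => [->|/(removing_cell rem)[y' ->]] // E.
  + by have := ltz y'; rewrite -E ltnn.
  + by have := ltz x'; rewrite E ltnn.
  + congr cell_incl; apply: inj; apply: val_inj.
    by rewrite /= -2!Ei E.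
- case: (eqVneq x z) => [->|/(removing_cell rem)[x' ->]];
  case: (eqVneq y z) => [->|/(removing_cell rem)[y' ->]] // E l.
  + by rewrite ltnn in l.
  + by case: (corner y'); rewrite ?E // ltnW.
  + by rewrite !Ei; apply: R.
- case: (eqVneq x z) => [->|/(removing_cell rem)[x' ->]];
  case: (eqVneq y z) => [->|/(removing_cell rem)[y' ->]] // E l.
  + by rewrite ltnn in l.
  + by case: (corner y'); rewrite ?E // ltnW.
  + by rewrite !Ei; apply: C.
Qed.

(** The preimage is the restriction of [T] to the cells of [nu]. *)
Lemma extend_filling_onto (la nu : seq nat) (z : cell la)
    (rem : obtained_by_removing la (val z) nu) (lt : sumn nu < sumn la)
    (T : filling la) :
  is_standard T -> holds_max T z ->
  exists2 T' : filling nu, is_standard T' & T = extend_filling lt T'.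
Proof.
move=> sT mz; have [inj R C] := is_standardP _ sT.
have sumE := removing_sumn (ssvalP z) rem.
have mzE : T z = sumn nu :> nat by apply: succn_inj; rewrite -sumE; apply/eqP.
(* Outside [z] the entries stay below the maximum, so they fit the smaller ordinal type required of
   a filling of [nu]. *)
have small y : T (cell_incl (removing_sub rem) y) < sumn nu.
  by rewrite -mzE; apply: ltn_holds_max => //; apply: cell_incl_neq.
exists [ffun y => Ordinal (small y)].
  apply/is_standardP; split=> x y; rewrite !ffunE.
  - by move=> [] /val_inj/inj/cell_incl_inj.
  - by move=> E l; apply: R.
  - by move=> E l; apply: C.
apply/ffunP => x; apply: val_inj.
case: (eqVneq x z) => [->|/(removing_cell rem)[y ->]].
  by rewrite /= mzE extend_filling_out // (removing_notin rem).
by rewrite /= extend_filling_incl ffunE.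
Qed.

Lemma extend_filling_inj (la nu : seq nat) (H : {subset diagram nu <= diagram la})
    (lt : sumn nu < sumn la) :
  injective (@extend_filling nu la lt).
Proof.
move=> T1 T2 E; apply/ffunP => y; apply: val_inj.
by rewrite /= -(extend_filling_incl lt H T1) E extend_filling_incl.
Qed.

(** * The statistic under deletion of the largest entry *)

(** The added cell holds the maximum, so it is never counted for another cell, and the remaining
    cells keep their positions and entries. *)
Lemma c_stat_incl (la nu : seq nat) (z : cell la)
    (rem : obtained_by_removing la (val z) nu) (lt : sumn nu < sumn la)
    (T : filling nu) (y : cell nu) :
  c_stat (extend_filling lt T) (cell_incl (removing_sub rem) y) = c_stat T y.
Proof.
have Ei := extend_filling_incl lt (removing_sub rem) T.
rewrite /c_stat -[RHS](card_imset _ (@cell_incl_inj _ _ (removing_sub rem))).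
apply: eq_card => w; rewrite inE.
case: (eqVneq w z) => [->|/(removing_cell rem)[w' ->]].
  rewrite (extend_filling_out lt T (removing_notin rem)) Ei.
  rewrite [X in _ && (_ && X)]ltnNge [X in ~~ X]ltnW ?ltn_ord // !andbF.
  by apply/esym/imsetP => -[y' _ E]; have := cell_incl_neq y' rem; rewrite -E eqxx.
by rewrite !Ei mem_imset ?inE //; apply: cell_incl_inj.
Qed.

(** The comparison of entries holds automatically at the maximum, so only positions matter: rows
    from [i] down to the bottom of column [j - 1]. *)
Lemma c_stat_max (la : seq nat) (T : filling la) (z : cell la) :
  is_partition la -> is_standard T -> holds_max T z -> 1 < cell_col z ->
  c_stat T z = part (conjugate la) (cell_col z - 1) - (cell_row z - 1).
Proof.
move=> pla sT mz; case: z mz => -[i j] zla mz; rewrite /cell_col /cell_row /= => j1.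
have := zla; rewrite mem_diagram => /and3P[i0 _ jle].
have := leq_part pla i0 => le1.
rewrite part_conjugate; try lia.
rewrite /c_stat cardE -(size_map val).
set mu := count _ _.
(* The counted cells are listed explicitly: the interval starting at [i] with this length ends at
   row [mu]. *)
have E : mu - (i - 1) = size [seq (i', j - 1) | i' <- iota i (mu - (i - 1))].
  by rewrite size_map size_iota.
rewrite {}E; apply: perm_size; apply: uniq_perm.
- by rewrite map_inj_uniq ?enum_uniq //; apply: val_inj.
- by rewrite map_inj_uniq ?iota_uniq // => a b [].
case=> i' j'; apply/mapP/mapP => [[y]|[k + [-> ->]]].
  rewrite mem_enum inE => /and3P[]; case: y => -[a b] yla /= ra.
  rewrite /cell_col /= => /eqP cb _ [-> ->].
  exists a; last by congr pair; lia.
  have := yla; rewrite mem_diagram => /and3P[a0 b0].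
  rewrite leq_count_part // mem_iota /mu.
  have -> : b = j - 1 by lia.
  by move: ra; rewrite /cell_row /=; lia.
rewrite mem_iota => kr.
have kla : (k, j - 1) \in diagram la.
  by rewrite mem_diagram leq_count_part //; rewrite -/mu; lia.
exists (SeqSub kla) => //; rewrite mem_enum inE /cell_row /cell_col /=.
rewrite ltn_holds_max ?andbT //; last by rewrite -val_eqE /= xpair_eqE; lia.
by lia.
Qed.

Local Open Scope ring_scope.

Lemma c_q_extend (la nu : seq nat) (z : cell la)
    (rem : obtained_by_removing la (val z) nu) (lt : (sumn nu < sumn la)%N)
    (T : filling nu) :
  is_partition la -> is_standard T ->
  c_q (extend_filling lt T) =
    qint (if cell_col z == 1%N then 1%N
          else (part (conjugate la) (cell_col z - 1) - (cell_row z - 1))%N) * c_q T.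
Proof.
move=> pla sT.
have /andP[sE mE] := extend_filling_standard rem lt sT.
have col0 : (0 < cell_col z)%N.
  by have := ssvalP z; rewrite [ssval z]surjective_pairing mem_diagram => /and3P[].
(* Giving first-column cells the factor 1 lets [z] be split off whatever its column; this matches
   the convention [qint 1 = 1] when [z] lies in column 1. *)
rewrite /c_q big_mkcond (bigD1 z) //=; congr (_ * _).
  case: (eqVneq (cell_col z) 1%N) => [->|ne].
    by rewrite /qint big_nat1 expr0.
  by have lt1 : (1 < cell_col z)%N by [lia]; rewrite lt1 c_stat_max.
rewrite [RHS]big_mkcond /=.
(* The cells other than [z] are reindexed by the cells of [nu]. *)
rewrite (eq_bigl (fun x => x \in [set cell_incl (removing_sub rem) y | y in [set: cell nu]])).
  rewrite big_imset /=; last by move=> ? ? _ _; apply: cell_incl_inj.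
  rewrite (eq_bigl xpredT) => [|y]; last by rewrite inE.
  by apply: eq_bigr => y _; rewrite c_stat_incl.
move=> x; apply/idP/imsetP => [/(removing_cell rem)[y ->]|[y _ ->]].
  by exists y.
exact: cell_incl_neq.
Qed.

(** * Summation over tableaux and removable cells *)

(** Extension is a bijection from the standard tableaux of shape [nu] onto those with maximum at
    [z], and it multiplies each weight by the same factor. *)
Lemma sum_holds_max (la nu : seq nat) (z : cell la) :
  is_partition la -> obtained_by_removing la (val z) nu ->
  \sum_(T : filling la | is_standard T && holds_max T z) c_q T =
    qint (if cell_col z == 1%N then 1%N
          else (part (conjugate la) (cell_col z - 1) - (cell_row z - 1))%N) * b_poly nu.
Proof.
move=> pla rem.
have lt : (sumn nu < sumn la)%N by rewrite (removing_sumn (ssvalP z) rem).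
rewrite /b_poly big_distrr /=.
under [RHS]eq_bigr => T sT do rewrite -(c_q_extend rem lt) //.
rewrite (eq_bigl (fun T => T \in [set extend_filling lt T' | T' in @is_standard nu])).
  by rewrite big_imset //= => ? ? _ _; apply: extend_filling_inj (removing_sub rem) lt _ _.
move=> T; apply/andP/imsetP => [[sT mT]|[T' sT' ->]].
  by have [T' sT' ->] := extend_filling_onto rem lt sT mT; exists T'.
by apply/andP; apply: extend_filling_standard.
Qed.

(** The family indexed by ['I_r] lists each removable cell once. The empty partition is excluded:
    there the left side is 1, while the sum is empty. *)
Theorem theorem3p8 (la : seq nat) (r : nat) (i j : 'I_r -> nat)
    (lam : 'I_r -> seq nat) :
  is_partition la -> (0 < size la)%N ->
  injective (fun s => (i s, j s)) ->
  (forall x : nat * nat, removable la x <-> exists s, (i s, j s) = x) ->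
  (forall s, obtained_by_removing la (i s, j s) (lam s)) ->
  b_poly la =
    \sum_(s < r)
      qint (if j s == 1%N then 1%N
            else (part (conjugate la) (j s - 1) - (i s - 1))%N) * b_poly (lam s).
Proof.
move=> pla la0 inj corners rem.
have zla s : (i s, j s) \in diagram la.
  by have [_ /(_ (ex_intro _ s erefl))[]] := corners (i s, j s).
pose z s : cell la := SeqSub (zla s).
have z_inj : injective z by move=> s t [E1 E2]; apply: inj; rewrite E1 E2.
rewrite b_poly_split_max; last first.
  case: la pla la0 {corners rem zla z z_inj} => [|a la] //= /andP[_ /= /andP[a0 _]] _.
  by lia.
(* Cells outside the list are not removable, so no standard tableau has its maximum there and their
   terms vanish. *)
rewrite (bigID (mem (z @: setT))) /= [X in _ + X]big1 ?addr0 => [|x xz]; last first.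
  rewrite big_pred0 // => T; apply/negbTE/negP => /andP[sT mT].
  have [+ _] := corners (val x).
  case/(_ (holds_max_removable pla sT mT)) => s E.
  by case/imsetP: xz; exists s => //; apply: val_inj; rewrite -E.
rewrite big_imset /=; last by move=> ? ? _ _; apply: z_inj.
rewrite (eq_bigl xpredT) => [|s]; last by rewrite inE.
by apply: eq_bigr => s _; exact: (sum_holds_max (z := z s) pla (rem s)).
Qed.
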